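(* Let $\mathcal{G}=\bigcup_{d\ge1}\mathcal{G}_d$ be a graded family of connected graphs with tethering $\{f_d(x)\}_{d\ge1}$, and let $h$ be a function that is positive on $[1,\infty)$. Suppose that for every positive integer $d$, \[ f_d(x)=\begin{cases}1 & \text{if } 1\le x<2,\\ h(d)\cdot x & \text{if } 2\le x.\end{cases} \] If $n$ and $d$ are positive integers with $h(d)>8$, $n\ge 8\,h(d)$, and \[ \sqrt n\ \ge\ \frac{2}{1-\sqrt{8/h(d)}}, \] then every graph $G\in\mathcal{G}_d$ on $n$ vertices is well-burnable.
   Context: Graphs are finite, simple, undirected and connected. Burning process on a graph $G$: in round 1 one vertex is chosen and set on fire; in each subsequent round, first every burning vertex sets all its neighbours on fire, then one new vertex is chosen and set on fire; the process ends when all vertices are on fire. The burning number $b(G)$ is the minimum number of rounds needed; a graph on $n$ vertices is well-burnable if $b(G)\le\lceil\sqrt n\,\rceil$. $d(u,v)$ is graph distance, $\mathrm{ecc}(v)=\max_u d(u,v)$, $\mathrm{rad}(G)=\min_v\mathrm{ecc}(v)$, and $N_r(v)=\{u:d(u,v)\le r\}$. A graded family of connected graphs is a class of connected graphs written as $\mathcal{G}=\bigcup_{d=1}^\infty\mathcal{G}_d$. It is tethered, with tethering $\{f_d\}_{d\ge1}$ (functions defined on $[1,\infty)$), if for every positive integer $d$, every $G\in\mathcal{G}_d$, every $r\in\{1,\dots,\mathrm{rad}(G)\}$ and every $v\in V(G)$, $|N_r(v)|\ge f_d(r)$. *)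

(* Defs.v *)
From mathcomp Require Import all_boot all_order all_algebra.
From mathcomp Require Import reals.

Set Implicit Arguments.
Unset Strict Implicit.
Unset Printing Implicit Defensive.

Import Order.TTheory GRing.Theory Num.Theory.

Record sgraph := SGraph {
  vertex :> finType;
  adj : rel vertex;
  adj_sym : symmetric adj;
  adj_irr : irreflexive adj
}.

Definition connected_graph (G : sgraph) : Prop :=
  forall u v : G, connect (@adj G) u v.

Section Metric.
Variable G : sgraph.

Definition walk (k : nat) (u v : G) : bool :=
  [exists p : k.-tuple G, path (@adj G) u p && (last u p == v)].

(* Least length of a walk from u to v. Distances in a connected graph are less
   than #|G|; if v cannot be reached from u the value is #|G|. *)
Definition dist (u v : G) : nat := find (fun k => walk k u v) (iota 0 #|G|).

Definition ecc (v : G) : nat := \max_(u : G) dist u v.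

(* Every eccentricity is at most #|G|, so the default value of the minimum
   only matters for the graph without vertices. *)
Definition rad : nat := \big[minn/#|G|]_(v : G) ecc v.

Definition nball (r : nat) (v : G) : {set G} := [set u | dist u v <= r].

End Metric.

Section Burning.
Variable G : sgraph.

Definition spread (B : {set G}) : {set G} :=
  B :|: [set v | [exists u in B, adj u v]].

(* One round, from the burning set B to the burning set B': the fire spreads,
   then a vertex that is not yet burning is set on fire; if the spreading has
   already burnt every vertex, no choice is left and the process ends with this
   round. The first round is the case B = set0. *)
Definition burning_round (B B' : {set G}) : bool :=
  let S := spread B in
  if S == [set: G] then B' == S
  else [exists x, (x \notin S) && (B' == x |: S)].

Definition burnt_in (k : nat) : bool :=
  [exists s : k.-tuple {set G},
    path burning_round set0 s && (last set0 s == [set: G])].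

Lemma burning_extend (B : {set G}) :
  exists s : seq {set G}, path burning_round B s && (last B s == [set: G]).
Proof.
elim: {B}_.+1 {-2}B (ltnSn #|~: B|) => // n IHn B ltBn.
have [->|BnT] := eqVneq B setT; first by exists [::] => /=.
have sBS : B \subset spread B by apply: subsetUl.
have [ST|SnT] := eqVneq (spread B) setT.
  by exists [:: setT]; rewrite /= /burning_round ST !eqxx.
have /subsetPn[x _ xS] : ~~ (setT \subset spread B) by rewrite subTset.
have ltB' : #|~: (x |: spread B)| < n.
  rewrite -ltnS; apply: leq_ltn_trans ltBn; apply: proper_card; apply/properP; split.
    by rewrite setCS (subset_trans sBS) ?subsetUr.
  exists x; first by rewrite inE; apply: contra xS => /(subsetP sBS).
  by rewrite !inE eqxx.
have [s /andP[ps ls]] := IHn _ ltB'.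
exists ((x |: spread B) :: s); rewrite /= ps ls !andbT /burning_round.
by rewrite (negPf SnT); apply/existsP; exists x; rewrite xS eqxx.
Qed.

Lemma ex_burnt_in : exists k, burnt_in k.
Proof.
have [s ps] := burning_extend set0.
by exists (size s); apply/existsP; exists (in_tuple s).
Qed.

Definition burning_number : nat := ex_minn ex_burnt_in.

Definition well_burnable (R : realType) : Prop :=
  (burning_number%:Z <= Num.ceil (Num.sqrt (#|G|%:R : R)))%R.

End Burning.

Arguments well_burnable G R : clear implicits.

(* F d is the class of graphs of grade d; the value F 0 is ignored. *)
Definition graded_family (F : nat -> sgraph -> Prop) : Prop :=
  forall (d : nat) (G : sgraph), 0 < d -> F d G -> connected_graph G.

Definition tethering (R : realType) (F : nat -> sgraph -> Prop)
    (f : nat -> R -> R) : Prop :=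
  forall (d : nat) (G : sgraph) (r : nat) (v : G),
    0 < d -> F d G -> 1 <= r <= rad G -> (f d r%:R <= #|nball r v|%:R)%R.

(* Main.v *)
Require Import Defs.
From mathcomp Require Import all_boot all_order all_algebra.
From mathcomp Require Import reals.
From mathcomp Require Import ring lra.
Import Order.TTheory GRing.Theory Num.Theory.
Local Open Scope ring_scope.

(** Take a maximal set of [p] centres whose balls of radius [r] are pairwise
    disjoint. Tethering gives [p * (h r) <= n], and by maximality the balls of
    radius [2 r] around the centres cover the graph, so lighting the centres in
    turn and then waiting burns it in [p + 2 r] rounds. For
    [r = ceil (sqrt (n / (2 h)))] this is at most [sqrt (8 n / h) + 2 <= sqrt n].
    If [r] exceeds the radius, a single fire at a centre of the graph suffices. *)

Section Spread.
Local Open Scope nat_scope.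
Variable G : sgraph.
Implicit Types (B C : {set G}) (s : seq G).

Lemma sub_spread B : B \subset spread B.
Proof. exact: subsetUl. Qed.

Lemma spreadS B C : B \subset C -> spread B \subset spread C.
Proof.
move=> sBC; apply: setUSS => //; apply/subsetP => v; rewrite !inE.
case/exists_inP => u uB uv; apply/exists_inP; exists u => //.
exact: (subsetP sBC).
Qed.

Lemma iter_spreadS m B C :
  B \subset C -> iter m (@spread G) B \subset iter m (@spread G) C.
Proof. by move=> sBC; elim: m => //= m; apply: spreadS. Qed.

Lemma iter_spread_leq m1 m2 B :
  m1 <= m2 -> iter m1 (@spread G) B \subset iter m2 (@spread G) B.
Proof.
move/subnK <-; elim: (m2 - m1) => //= m IH.
exact: subset_trans IH (sub_spread _).
Qed.

Lemma path_iter_spread u (p : seq G) B :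
  u \in B -> path (@adj G) u p ->
  last u p \in iter (size p) (@spread G) B.
Proof.
elim: p u B => [|v p IH] u B uB //= /andP[uv pp].
rewrite -iterS iterSr; apply: IH => //.
by rewrite !inE; apply/orP; right; apply/exists_inP; exists u.
Qed.

(** A round may only light a vertex that is not yet burning. If [x] already burns after the spread,
    some unburnt [y] is lit in its place; if everything burns, nothing is lit. *)
Lemma burning_round_exists B x :
  exists2 B', burning_round B B' & x |: spread B \subset B'.
Proof.
rewrite /burning_round; have [ST|SnT] := eqVneq (spread B) setT.
  by exists (spread B); rewrite // ST subsetT.
have [xS|xS] := boolP (x \in spread B); last first.
  by exists (x |: spread B) => //; apply/existsP; exists x; rewrite xS eqxx.
have /subsetPn[y _ yS] : ~~ (setT \subset spread B) by rewrite subTset.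
exists (y |: spread B); first by apply/existsP; exists y; rewrite yS eqxx.
by rewrite subUset sub1set in_setU xS orbT subsetUr.
Qed.

(* A vertex of [s] that already burns when its turn comes is replaced by an
   arbitrary one, hence inclusions rather than equalities. *)
Lemma burning_schedule s B :
  exists t : seq {set G},
    [/\ size t = size s, path (@burning_round G) B t,
        iter (size s) (@spread G) B \subset last B t &
        forall s1 c s2, s = s1 ++ c :: s2 ->
          iter (size s2) (@spread G) [set c] \subset last B t].
Proof.
elim: s B => [|x s IH] B; first by exists [::]; split=> // -[].
have [B' BB'] := burning_round_exists B x.
rewrite subUset => /andP[xB' sB'].
have [t [st pt lt ct]] := IH B'.
exists (B' :: t); split=> /=; first by rewrite st.
- by rewrite BB'.
- by rewrite -iterS iterSr; apply: subset_trans (iter_spreadS _ _ _ sB') lt.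
case=> [|y s1] c s2 /= []; last by move=> _; apply: ct.
(* For the head of the list, the third clause applied to [B'], which contains [c], gives the
   claim. *)
by move=> <- <-; apply: subset_trans (iter_spreadS _ _ _ xB') lt.
Qed.

(** The vertices of [A] are lit first, in any order, followed by [m] filler entries [x0], so each of
    them has at least [m] further rounds to spread. *)
Lemma burning_number_cover (x0 : G) (A : {set G}) m :
  (forall v, exists2 c, c \in A & v \in iter m (@spread G) [set c]) ->
  burning_number G <= #|A| + m.
Proof.
move=> covA; rewrite /burning_number; case: ex_minnP => k _; apply.
have [t [st pt _ ct]] := burning_schedule (enum A ++ nseq m x0) set0.
have szt : size t == #|A| + m by rewrite st size_cat size_nseq -cardE.
apply/existsP; exists (Tuple szt); rewrite pt /= -subTset.
apply/subsetP => v _; have [c] := covA v; rewrite -mem_enum => cA vc.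
case/splitPr: cA ct => s1 s2 /(_ s1 c (s2 ++ nseq m x0)).
rewrite -catA => /(_ erefl) /subsetP; apply.
apply: (subsetP _ _ vc); apply: iter_spread_leq.
by rewrite size_cat size_nseq leq_addl.
Qed.

Hypothesis connG : connected_graph G.

(** The default value of [dist] does not occur in a connected graph: a path without repeated
    vertices has fewer than [#|G|] edges. *)
Lemma dist_path u v :
  exists p, [/\ path (@adj G) u p, last u p = v & size p = dist u v].
Proof.
have : has (fun k => walk k u v) (iota 0 #|G|).
  have /connectP[p pp lp] := connG u v.
  case: (shortenP pp) lp => q qp uq _ lq; apply/hasP; exists (size q).
    by rewrite mem_iota /= add0n; have := card_uniqP uq => /= <-; apply: max_card.
  by apply/existsP; exists (in_tuple q); rewrite qp lq eqxx.
move=> hasw; have := nth_find 0 hasw; rewrite -/(dist u v) nth_iota; last first.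
  by move: hasw; rewrite has_find size_iota.
by case/existsP => p /andP[pp /eqP lp]; exists p; rewrite size_tuple.
Qed.

Lemma dist_iter_spread m u v (B : {set G}) :
  dist u v <= m -> u \in B -> v \in iter m (@spread G) B.
Proof.
move=> duv uB; have [p [pp lp sp]] := dist_path u v.
apply: (subsetP (iter_spread_leq _ _ _ duv)); rewrite -sp -lp.
exact: path_iter_spread.
Qed.

(** Balls are defined by walks towards their centre, while fire leaves the centre; hence the walk is
    reversed. *)
Lemma dist_sym_iter_spread m u v (B : {set G}) :
  dist u v <= m -> v \in B -> u \in iter m (@spread G) B.
Proof.
move=> duv vB; have [p [pp lp sp]] := dist_path u v.
apply: (subsetP (iter_spread_leq _ _ _ duv)); rewrite -sp.
have -> : u = last v (rev (belast u p)).
  by case: (p) lp => //= y q _; rewrite rev_cons last_rcons.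
rewrite -(size_belast u p) -size_rev; apply: path_iter_spread => //.
by rewrite -lp rev_path; apply: sub_path pp => x y; rewrite adj_sym.
Qed.

Lemma ecc_le_rad (x0 : G) : exists v : G, ecc v <= Defs.rad G.
Proof.
rewrite /Defs.rad; elim/big_ind: _ => [|m1 m2 [v1 h1] [v2 h2]|v _]; last by exists v.
  (* The default [#|G|] of the minimum bounds [ecc x0], since [find] never exceeds the length of its
     list. *)
  exists x0; apply/bigmax_leqP => u _.
  by rewrite -[leqRHS](size_iota 0); apply: find_size.
by case: (leqP m1 m2) => _; [exists v1 | exists v2].
Qed.

Lemma burning_number_rad (x0 : G) : burning_number G <= (Defs.rad G).+1.
Proof.
have [v ev] := ecc_le_rad x0.
rewrite -add1n -(cards1 v); apply: burning_number_cover => // u.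
exists v; first by rewrite inE.
apply: dist_sym_iter_spread (set11 v); apply: leq_trans ev.
exact: (leq_bigmax u).
Qed.

End Spread.

Lemma maximal_packing (T : finType) (F : T -> {set T}) :
  (forall v, v \in F v) ->
  exists A : {set T}, (\sum_(c in A) #|F c| <= #|T|)%N /\
    forall v, exists2 c, c \in A & ~~ [disjoint F v & F c].
Proof.
move=> F_refl.
pose P (A : {set T}) := [forall c in A, forall c' in A,
  (c != c') ==> [disjoint F c & F c']].
have PP (A : {set T}) :
    reflect {in A &, forall c c', c != c' -> [disjoint F c & F c']} (P A).
  apply: (iffP forall_inP) => [h c c' cA c'A|h c cA].
    by move/forall_inP: (h c cA) => /(_ c' c'A) /implyP.
  by apply/forall_inP => c' c'A; apply/implyP; apply: h.
have [|A /maxsetP[/PP PA maxA]] := @ex_maxset T P.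
  by exists set0; apply/PP => c c'; rewrite inE.
exists A; split.
  (* Double counting: by disjointness each [u] lies in [F c] for at most one [c] in [A]. *)
  rewrite (eq_bigr (fun c => \sum_(u : T) (u \in F c))%N); last first.
    by move=> c _; rewrite -sum1_card big_mkcond.
  rewrite exchange_big -[leqRHS]sum1_card; apply: leq_sum => u _.
  rewrite -big_mkcondr sum1_card; apply/card_le1_eqP => c c'.
  move=> /andP[cA uc] /andP[c'A uc']; apply/eqP/contraT => cc'.
  by have /pred0P/(_ u) := PA c' c c'A cA cc'; rewrite /= uc uc'.
move=> v; apply/exists_inP/contraT; rewrite negb_exists_in.
move/forall_inP => disjv.
(* If [F v] met no [F c], adding [v] would keep the sets disjoint, so [v] is in [A] by maximality;
   then [F v] is disjoint from itself, against [F_refl]. *)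
have vA : v \in A.
  rewrite -(maxA (v |: A)) ?setU11 ?subsetUr //; apply/PP => c c'.
  rewrite !in_setU1 => /predU1P[->|cA] /predU1P[->|c'A]; first by rewrite eqxx.
  - by have := disjv _ c'A; rewrite negbK.
  - by have := disjv _ cA; rewrite negbK disjoint_sym.
  - exact: PA.
by have := disjv v vA; rewrite negbK => /pred0P/(_ v); rewrite /= F_refl.
Qed.

(** The ball of any [v] shares a vertex [u] with the ball of some centre [c]; fire goes from [c] to
    [u] and from [u] to [v] in at most [r] rounds each. *)
Lemma burning_number_packing {G : sgraph} (connG : connected_graph G) (x0 : G)
    (r : nat) :
  exists A : {set G}, (\sum_(c in A) #|nball r c| <= #|G|)%N /\
    (burning_number G <= #|A| + r.*2)%N.
Proof.
have [v|A [sumA covA]] := maximal_packing G (nball r).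
  (* [dist v v] computes to 0 once [#|G|] is known to be a successor. *)
  rewrite inE /dist; case: #|G| (max_card (pred1 v)); rewrite ?card1 // => n _.
  rewrite /= (_ : walk 0 v v) //.
  by apply/existsP; exists [tuple]; rewrite /= eqxx.
exists A; split=> //; apply: burning_number_cover => // v.
have [c cA /pred0Pn[u /andP[]]] := covA v; rewrite !inE => duv duc.
exists c => //; rewrite -addnn iterD.
apply: (dist_iter_spread _ connG _ u) => //.
by apply: (dist_sym_iter_spread _ connG _ u c) => //; apply: set11.
Qed.

Lemma nat_ceil (R : realType) (x : R) :
  0 <= x -> exists r : nat, x <= r%:R < x + 1.
Proof.
move=> x0; exists `|Num.ceil x|%N.
have c0 : 0 <= Num.ceil x by rewrite ceil_ge0; lra.
have := ceil_itv x; rewrite natr_absz ger0_norm // rmorphB /= => /andP[h1 h2].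
by rewrite h2 /=; lra.
Qed.

Theorem theorem7 (R : realType) (F : nat -> sgraph -> Prop)
  (f : nat -> R -> R) (h : R -> R)
  (hF : graded_family F) (hf : tethering F f)
  (h_pos : forall x : R, 1 <= x -> 0 < h x)
  (f_eq : forall d : nat, (0 < d)%N ->
     (forall x : R, 1 <= x < 2 -> f d x = 1) /\
     (forall x : R, 2 <= x -> f d x = h d%:R * x))
  (n d : nat) (n_gt0 : (0 < n)%N) (d_gt0 : (0 < d)%N)
  (hd_gt8 : 8 < h d%:R)
  (n_ge : 8 * h d%:R <= n%:R)
  (sqrtn_ge : 2 / (1 - Num.sqrt (8 / h d%:R)) <= Num.sqrt n%:R) :
  forall G : sgraph, F d G -> #|G| = n -> well_burnable G R.
Proof.
move=> G FdG cardG; have connG := hF d G d_gt0 FdG.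
have [x0 _] : exists x0 : G, x0 \in G by apply/card_gt0P; rewrite cardG.
suff [m bm mn] : exists2 m, (burning_number G <= m)%N &
    m%:R <= Num.sqrt (n%:R : R).
  rewrite /well_burnable cardG -(ler_int R); apply: le_trans (ceil_ge _).
  by apply: le_trans mn; rewrite -pmulrn ler_nat.
have [_ fE] := f_eq d d_gt0.
set H := h d%:R in hd_gt8 n_ge sqrtn_ge fE.
have H0 : 0 < H by lra.
(* This choice balances the two costs: [n / (H * x) = 2 * x]. *)
pose x : R := Num.sqrt (n%:R / (2 * H)).
have x2 : x ^+ 2 = n%:R / (2 * H).
  by rewrite sqr_sqrtr // divr_ge0 // mulr_ge0 // ltW.
have x2H : 2 * H * x ^+ 2 = n%:R by rewrite x2 mulrC divfK // mulf_neq0 // gt_eqF.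
have x_ge0 : 0 <= x by apply: sqrtr_ge0.
(* From [n >= 8 * H]; it places [r] on the linear branch of [f d]. *)
have x_ge2 : 2 <= x.
  by rewrite -ler_sqr ?nnegrE // -(ler_pM2l (_ : 0 < 2 * H)) ?x2H; lra.
(* With [s = sqrt (8 / H) < 1], the hypothesis says [2 <= (1 - s) * sqrt n], and
   [4 * x = s * sqrt n]. *)
have sqrtn : 4 * x + 2 <= Num.sqrt n%:R.
  have s1 : Num.sqrt (8 / H) < 1.
    by rewrite -[ltRHS]sqrtr1 ltr_sqrt // ltr_pdivrMr // mul1r.
  have -> : 4 * x = Num.sqrt n%:R * Num.sqrt (8 / H).
    rewrite -sqrtrM // -[LHS]ger0_norm ?mulr_ge0 // -sqrtr_sqr; congr Num.sqrt.
    by rewrite exprMn x2; field; rewrite gt_eqF.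
  by move: sqrtn_ge; rewrite ler_pdivrMr; lra.
have [r /andP[xr rx]] := nat_ceil _ _ x_ge0.
have [r_rad|rad_r] := leqP r (Defs.rad G); last first.
  exists r; last lra.
  exact: leq_trans (burning_number_rad _ connG x0) rad_r.
have [A [sumA bA]] := burning_number_packing connG x0 r.
exists (#|A| + r.*2)%N => //.
have ballH (c : G) : H * r%:R <= #|nball r c|%:R.
  rewrite -fE; last lra.
  by apply: (hf d G r c d_gt0 FdG); rewrite r_rad andbT -(ler_nat R); lra.
have pn : #|A|%:R * (H * r%:R) <= n%:R.
  rewrite -cardG; move: sumA; rewrite -(ler_nat R); apply: le_trans.
  by rewrite natr_sum mulr_natl -sumr_const; apply: ler_sum => c _.
(* Since [x <= r], [#|A| * (H * x) <= n = 2 * x * (H * x)]. *)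
have p2x : #|A|%:R <= 2 * x.
  rewrite -(ler_pM2r (_ : 0 < H * x)); last by apply: mulr_gt0; lra.
  apply: le_trans (_ : #|A|%:R * (H * r%:R) <= _); last first.
    by apply: le_trans pn _; rewrite -x2H; lra.
  by do 2!(apply: ler_wpM2l; first by [|lra]).
(* The total is at most [2 * x + 2 * (x + 1) = 4 * x + 2]. *)
by rewrite natrD -muln2 natrM; lra.
Qed.
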